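(* Let $G$ be a locally compact group with right Haar measure $\vartheta$, let $1\le p<\infty$, let $g\in G$ be aperiodic, and let $w:G\to(0,+\infty)$ be a bounded function. Suppose the weighted translation operator $T_{g,w}:\mathfrak{L}^p(G)\to\mathfrak{L}^p(G)$, $T_{g,w}(f)(x)=w(x)f(xg^{-1})$, is convex-cyclic and that the point spectrum of its adjoint is empty, $\sigma_p(T_{g,w}^* )=\emptyset$. Then for each compact subset $K\subset G$ with $\vartheta(K)>0$ there exist $N_0\in\mathbb{N}$, a sequence of Borel subsets $(E_n)$ of $K$, and a sequence $(a_n)\subseteq[0,1]$ with $\sum_{i=0}^\infty a_i=1$ such that $$1\Big/\liminf_{n\to\infty}\Big\Vert\Big(a_0\prod_{i=0}^{N_0-1}w*\delta_{g^{i}}+a_1\prod_{i=0}^{N_0}w*\delta_{g^{i}}+\cdots+a_n\prod_{i=0}^{N_0+n-1}w*\delta_{g^{i}}\Big)\Big|_{E_n}\Big\Vert_\infty=0.$$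
   Context: For $h\in G$, $\delta_h$ is the unit point mass at $h$ and $(f*\delta_h)(x)=f(xh^{-1})$; thus $(w*\delta_{g^{i}})(x)=w(xg^{-i})$. Products are pointwise, $F|_{E}$ denotes restriction to $E$, and $\Vert\cdot\Vert_\infty$ is the (essential) supremum norm. An element $g\in G$ is aperiodic if the closed subgroup generated by $g$ is not compact. A bounded linear operator $T$ on a Banach space $X$ is convex-cyclic if there is $x\in X$ such that the convex hull of $\{T^nx:n\ge0\}$ is dense in $X$. $T^*$ denotes the Banach-space adjoint acting on the dual space, and $\sigma_p$ denotes the set of eigenvalues. *)

(* Defs.v *)
From HB Require Import structures.
From mathcomp Require Import all_boot all_order all_algebra.
From mathcomp Require Import all_classical all_reals all_analysis ess_sup_inf.
From mathcomp.real_closed Require Import complex.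
Set Implicit Arguments. Unset Strict Implicit. Unset Printing Implicit Defensive.
Import Order.TTheory GRing.Theory Num.Theory.
Import numFieldNormedType.Exports.
Local Open Scope classical_set_scope.
Local Open Scope ring_scope.
Local Open Scope complex_scope.
Local Open Scope ring_scope.

Definition Borel (G : ptopologicalType) := g_sigma_algebraType (@open G).

Definition is_group (G : Type) (mul : G -> G -> G) (inv : G -> G) (one : G) :=
  [/\ forall x y z, mul x (mul y z) = mul (mul x y) z,
      forall x, mul one x = x, forall x, mul x one = x,
      forall x, mul (inv x) x = one & forall x, mul x (inv x) = one].

Definition is_LC_group (G : ptopologicalType) (mul : G -> G -> G)
    (inv : G -> G) (one : G) :=
  [/\ is_group mul inv one,
      continuous (fun xy : G * G => mul xy.1 xy.2),
      continuous inv,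
      hausdorff_space G &
      locally_compact [set: G]].

Definition gpow (G : Type) (mul : G -> G -> G) (inv : G -> G) (one : G)
    (g : G) (n : int) : G :=
  match n with
  | Posz k => iter k (mul g) one
  | Negz k => iter k.+1 (mul (inv g)) one
  end.

Definition is_subgroup (G : Type) (mul : G -> G -> G) (inv : G -> G) (one : G)
    (H : set G) :=
  [/\ H one, forall x y, H x -> H y -> H (mul x y) & forall x, H x -> H (inv x)].

Definition closed_subgroup_gen (G : ptopologicalType) (mul : G -> G -> G)
    (inv : G -> G) (one : G) (g : G) : set G :=
  \bigcap_(H in [set H : set G | is_subgroup mul inv one H /\ closed H /\ H g]) H.

Definition aperiodic (G : ptopologicalType) (mul : G -> G -> G)
    (inv : G -> G) (one : G) (g : G) :=
  ~ compact (closed_subgroup_gen mul inv one g).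

Definition right_translate (G : Type) (mul : G -> G -> G) (A : set G) (h : G) :=
  [set mul a h | a in A].

Definition is_right_Haar (R : realType) (G : ptopologicalType)
    (mul : G -> G -> G) (mu : {measure set (Borel G) -> \bar R}) :=
  [/\ (* nonzero *) (0 < mu [set: G])%E,
      forall (A : set (Borel G)) (h : G), measurable A ->
        mu (right_translate mul A h) = mu A,
      forall K : set G, compact K -> (mu K < +oo)%E,
      forall A : set (Borel G), measurable A ->
        mu A = ereal_inf [set mu U | U in [set U : set G | open U /\ A `<=` U]] &
      forall U : set G, open U ->
        mu U = ereal_sup [set mu K | K in [set K : set G | compact K /\ K `<=` U]]].

Definition measurableC (R : realType) (G : ptopologicalType)
    (f : Borel G -> R[i]) :=
  measurable_fun [set: Borel G] (fun x => complex.Re (f x)) /\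
  measurable_fun [set: Borel G] (fun x => complex.Im (f x)).

Definition pnorm (R : realType) (G : ptopologicalType)
    (mu : {measure set (Borel G) -> \bar R}) (p : R) (f : Borel G -> R[i]) : \bar R :=
  Lnorm mu p%:E (fun x => (Normc.normc (f x))%:E).

Definition inLp (R : realType) (G : ptopologicalType)
    (mu : {measure set (Borel G) -> \bar R}) (p : R) (f : Borel G -> R[i]) :=
  measurableC f /\ (pnorm mu p f < +oo)%E.

Definition wtrans (R : realType) (G : Type) (mul : G -> G -> G) (inv : G -> G)
    (g : G) (w : G -> R) (f : G -> R[i]) : G -> R[i] :=
  fun x => (w x)%:C * f (mul x (inv g)).

Definition convex_cyclic (R : realType) (G : ptopologicalType)
    (mu : {measure set (Borel G) -> \bar R}) (p : R)
    (T : (Borel G -> R[i]) -> (Borel G -> R[i])) :=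
  exists f, inLp mu p f /\
    forall h, inLp mu p h -> forall eps : R, 0 < eps ->
      exists (N : nat) (c : nat -> R),
        (forall k, 0 <= c k) /\ \sum_(k < N.+1) c k = 1 /\
        (pnorm mu p (fun x => h x - \sum_(k < N.+1) (c k)%:C * iter k T f x)%R < eps%:E)%E.

Definition Lp_dual (R : realType) (G : ptopologicalType)
    (mu : {measure set (Borel G) -> \bar R}) (p : R)
    (phi : (Borel G -> R[i]) -> R[i]) :=
  (forall (a : R[i]) f h, inLp mu p f -> inLp mu p h ->
      phi (fun x => a * f x + h x) = a * phi f + phi h) /\
  exists M : R, forall f, inLp mu p f ->
      ((Normc.normc (phi f))%:E <= M%:E * pnorm mu p f)%E.

(* lam is an eigenvalue of the Banach-space adjoint T^* of T on L^p :
   T^* phi = phi o T = lam phi for a nonzero phi in (L^p)^* *)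
Definition adjoint_eigenvalue (R : realType) (G : ptopologicalType)
    (mu : {measure set (Borel G) -> \bar R}) (p : R)
    (T : (Borel G -> R[i]) -> (Borel G -> R[i])) (lam : R[i]) :=
  exists phi, Lp_dual mu p phi /\
    (exists f, inLp mu p f /\ phi f <> 0) /\
    forall f, inLp mu p f -> phi (T f) = lam * phi f.

Definition adjoint_point_spectrum_empty (R : realType) (G : ptopologicalType)
    (mu : {measure set (Borel G) -> \bar R}) (p : R)
    (T : (Borel G -> R[i]) -> (Borel G -> R[i])) :=
  forall lam : R[i], ~ adjoint_eigenvalue mu p T lam.

Definition esssup_on (R : realType) (G : ptopologicalType)
    (mu : {measure set (Borel G) -> \bar R}) (E : set G) (F : G -> R) : \bar R :=
  ess_sup mu (fun x : Borel G => if x \in E then (`|F x|)%:E else 0%E).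

(* prod_{i=0}^{m-1} (w * delta_{g^i})(x) = prod_{i<m} w (x g^{-i}) *)
Definition wprod (R : realType) (G : Type) (mul : G -> G -> G) (inv : G -> G)
    (one : G) (g : G) (w : G -> R) (m : nat) (x : G) : R :=
  \prod_(i < m) w (mul x (inv (gpow mul inv one g (Posz i)))).

(* Main.v *)
Require Import Defs.
From HB Require Import structures.
From mathcomp Require Import all_boot all_order all_algebra.
From mathcomp Require Import all_classical all_reals all_analysis ess_sup_inf.
From mathcomp.real_closed Require Import complex.
From mathcomp Require Import lra measurable_realfun.
Import Order.TTheory GRing.Theory Num.Theory.
Import numFieldNormedType.Exports.
Local Open Scope classical_set_scope.
Local Open Scope ring_scope.
Set Implicit Arguments.
Unset Strict Implicit.
Unset Printing Implicit Defensive.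

(** Write [W_m = wprod m], so that [T^m f (x) = W_m(x) f(x g^-m)]. If the [W_m]
    were essentially bounded on [K] by one constant [C], then on [K] each
    [T^m f] would be dominated by [C |f(x g^-m)| <= C (1 + |f(x g^-m)|^p)],
    whose integral over [K] is bounded independently of [m] by right invariance;
    hence a large multiple of the indicator of [K] could not be approximated by
    convex combinations of the [T^m f]. So the essential suprema of the [W_m]
    on [K] are unbounded, and one takes [N0 = 0], [E_n = K] and weights [a]
    concentrated on a sparse set of indices at which these suprema are huge. *)

(** * Summable weights against an unbounded sequence *)

Lemma sum_half_powers (R : realType) (n : nat) :
  \sum_(j < n) 2^-1 ^+ j.+1 = 1 - 2^-1 ^+ n :> R.
Proof.
elim: n => [|n IH]; first by rewrite big_ord0 expr0 subrr.
rewrite big_ord_recr /= IH exprS.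
by lra.
Qed.

(* The mass 2^-(j+1) is put on an index m_j >= j at which u exceeds 2^(j+1) j;
   m_j >= j makes each a_k a finite sum even if m is not injective. *)
Lemma summable_weights_unbounded (R : realType) (u : nat -> \bar R) :
  (forall (C : R) N, exists m, (N <= m)%N /\ (C%:E <= u m)%E) ->
  exists a : nat -> R,
    [/\ forall n, 0 <= a n <= 1,
        (fun n => \sum_(i < n) a i) @ \oo --> (1 : R) &
        forall C : R, exists k, 0 < a k /\ (C%:E <= (a k)%:E * u k)%E].
Proof.
move=> uu.
have [m mP] := choice (fun j => uu (2 ^+ j.+1 * j%:R) j).
pose b j : R := 2^-1 ^+ j.+1.
have b0 j : 0 < b j by rewrite exprn_gt0.
pose a k := \sum_(j < k.+1 | m j == k) b j.
(* As [j <= m j], the condition [m j == k] already forces [j < k.+1], so any range [n > k] gives the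
   same sum. The common range allows the exchange of sums in [sumE]. *)
have aE n k : (k < n)%N -> a k = \sum_(j < n | m j == k) b j.
  move=> kn; rewrite /a (big_ord_widen_cond n (fun j => m j == k) b)//.
  apply: eq_bigl => j; case: eqP => //= mjk.
  by rewrite ltnS -mjk; case: (mP j).
have a0 k : 0 <= a k by apply: sumr_ge0 => j _; exact: ltW.
have sumE n : \sum_(k < n) a k = \sum_(j < n | (m j < n)%N) b j.
  under eq_bigr => k _ do rewrite (aE n k (ltn_ord k)) big_mkcond /=.
  rewrite exchange_big /= [RHS]big_mkcond /=; apply: eq_bigr => j _.
  rewrite -big_mkcond /=; case: ifPn => [mjn|mjn].
    rewrite (eq_bigl (fun k => k == Ordinal mjn)) ?big_pred1_eq// => k.
    by rewrite eq_sym.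
  rewrite big_pred0// => k; apply/negbTE; apply: contra mjn => /eqP ->.
  exact: ltn_ord.
have sum_le n : \sum_(k < n) a k <= 1.
  rewrite sumE; apply: (@le_trans _ _ (\sum_(j < n) b j)).
    rewrite big_mkcond /=; apply: ler_sum => j _; case: ifP => // _; exact: ltW.
  by rewrite sum_half_powers gerBl exprn_ge0.
have le_a j : b j <= a (m j).
  have jm : (j < (m j).+1)%N by rewrite ltnS; case: (mP j).
  rewrite /a (bigD1 (Ordinal jm)) //= lerDl sumr_ge0 // => i _; exact: ltW.
exists a; split.
- move=> n; rewrite a0 /=; apply: le_trans (sum_le n.+1).
  by rewrite big_ord_recr /= lerDr sumr_ge0.
- apply/cvgrPdist_le => e e0.
  have [J Je] : exists J, 2^-1 ^+ J <= e.
    have /cvgrPdist_le/(_ e e0)[J _ /(_ J (leqnn J))/=] :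
        (fun n => (2^-1 : R) ^+ n) @ \oo --> (0 : R).
      by apply: cvg_expr; rewrite ger0_norm// invf_lt1// ltr1n.
    rewrite sub0r normrN ger0_norm ?exprn_ge0// => ?; by exists J.
  (* This threshold is at least [J] and exceeds [m j] for every [j < J]. Beyond it the partial sum
     contains [b 0, ..., b (J-1)], so it misses at most [2^-J <= e] of the total mass. *)
  exists (J + \sum_(j < J) (m j).+1)%N => // n /= Jn.
  rewrite ger0_norm; last by rewrite subr_ge0; exact: sum_le.
  apply: (le_trans _ Je).
  rewrite lerBlDr -lerBlDl -(sum_half_powers R J) sumE.
  rewrite (big_ord_widen n b); last by apply: leq_trans Jn; rewrite leq_addr.
  rewrite big_mkcond [leRHS]big_mkcond /=; apply: ler_sum => j _.
  case: ifPn => [jJ|_]; last by case: ifP => // _; exact: ltW.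
  suff -> : (m j < n)%N by [].
  apply: leq_trans Jn; apply: leq_trans (leq_addl _ _).
  by rewrite (bigD1 (Ordinal jJ))//= leq_addr.
- move=> C; pose j := Num.bound `|C|.
  exists (m j); split; first exact: lt_le_trans (le_a j).
  have [_ uj] := mP j.
  (* Replacing [b j] by the larger [a (m j)] needs [u (m j)] nonnegative, which follows from its
     lower bound. The factor [2 ^+ j.+1] then cancels [b j], leaving [j >= C]. *)
  apply: (@le_trans _ _ ((b j)%:E * u (m j))%E); last first.
    rewrite lee_wpmul2r ?lee_fin//; apply: le_trans uj.
    by rewrite lee_fin mulr_ge0// exprn_ge0.
  apply: (@le_trans _ _ ((b j)%:E * (2 ^+ j.+1 * j%:R)%:E)%E); last first.
    by rewrite lee_wpmul2l// lee_fin ltW.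
  rewrite -EFinM lee_fin mulrA /b exprVn mulVf ?expf_neq0// mul1r.
  exact: le_trans (ler_norm _) (ltW (archi_boundP (normr_ge0 C))).
Qed.

(** * Complex-valued Borel functions: measurability, moduli and integrals *)

Section borel_group.
Variables (R : realType) (G : ptopologicalType).
Variable (mu : {measure set (Borel G) -> \bar R}).
Implicit Types (f h : Borel G -> R[i]) (a : Borel G -> R).

Lemma continuous_borel_measurable (phi : G -> G) : continuous phi ->
  measurable_fun [set: Borel G] (phi : Borel G -> Borel G).
Proof.
move=> cphi; apply: (@measurability _ _ (Borel G) (Borel G) setT phi (@open G)) => // _ [U oU <-].
by rewrite setTI; apply: sub_sigma_algebra; move/continuousP: cphi; apply.
Qed.

Lemma compact_borel_measurable (K : set G) : hausdorff_space G -> compact K ->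
  measurable (K : set (Borel G)).
Proof.
move=> hG cK; rewrite -[K]setCK; apply: measurableC.
apply: sub_sigma_algebra; apply: closed_openC; exact: compact_closed.
Qed.

Lemma measurableCB f h : Defs.measurableC f -> Defs.measurableC h ->
  Defs.measurableC (fun x => f x - h x).
Proof.
move=> [fR fI] [hR hI]; split.
  rewrite (_ : (fun x => _) = (fun x => complex.Re (f x) - complex.Re (h x))).
    exact: measurable_funB.
  by apply/funext => x; case: (f x); case: (h x).
rewrite (_ : (fun x => _) = (fun x => complex.Im (f x) - complex.Im (h x))).
  exact: measurable_funB.
by apply/funext => x; case: (f x); case: (h x).
Qed.

Lemma measurableCZ a f : measurable_fun setT a -> Defs.measurableC f ->
  Defs.measurableC (fun x => (a x)%:C%C * f x).
Proof.
move=> ma [fR fI]; split.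
  rewrite (_ : (fun x => _) = (fun x => a x * complex.Re (f x))).
    exact: measurable_funM.
  by apply/funext => x; case: (f x) => u v; rewrite /= mul0r subr0.
rewrite (_ : (fun x => _) = (fun x => a x * complex.Im (f x))).
  exact: measurable_funM.
by apply/funext => x; case: (f x) => u v; rewrite /= mul0r addr0.
Qed.

Lemma measurableC_sum (n : nat) (F : nat -> Borel G -> R[i]) :
  (forall k, Defs.measurableC (F k)) -> Defs.measurableC (fun x => \sum_(k < n) F k x).
Proof.
move=> mF; split.
  rewrite (_ : (fun x => _) = (fun x => \sum_(k < n) complex.Re (F k x))).
    by apply: measurable_sum => k; case: (mF k).
  by apply/funext => x; rewrite raddf_sum.
rewrite (_ : (fun x => _) = (fun x => \sum_(k < n) complex.Im (F k x))).
  by apply: measurable_sum => k; case: (mF k).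
by apply/funext => x; rewrite raddf_sum.
Qed.

Lemma measurableC_real a : measurable_fun setT a ->
  Defs.measurableC (fun x => (a x)%:C%C).
Proof. by move=> ma; split => //=; exact: measurable_cst. Qed.

Lemma measurableC_comp (phi : Borel G -> Borel G) f :
  measurable_fun setT phi -> Defs.measurableC f -> Defs.measurableC (f \o phi).
Proof.
move=> mphi [fR fI]; split.
  exact: (measurableT_comp fR mphi).
exact: (measurableT_comp fI mphi).
Qed.

Lemma measurable_normc f : Defs.measurableC f ->
  measurable_fun setT (fun x => Normc.normc (f x)).
Proof.
move=> [fR fI].
rewrite (_ : (fun x => _) = (@Num.sqrt R) \o
   (fun x => complex.Re (f x) ^+ 2 + complex.Im (f x) ^+ 2)); last first.
  by apply/funext => x /=; case: (f x).
apply: measurableT_comp.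
  apply: continuous_measurable_fun; exact: sqrt_continuous.
by apply: measurable_funD; apply: measurable_funX.
Qed.

Lemma normc_ge0 (z : R[i]) : 0 <= Normc.normc z.
Proof. by case: z => u v; exact: sqrtr_ge0. Qed.

Lemma normc_real (r : R) : Normc.normc (r%:C)%C = `|r|.
Proof. by rewrite /Normc.normc /= expr0n/= addr0 sqrtr_sqr. Qed.

Lemma normc_sum (n : nat) (F : nat -> R[i]) :
  Normc.normc (\sum_(k < n) F k) <= \sum_(k < n) Normc.normc (F k).
Proof.
elim: n => [|n IH]; first by rewrite !big_ord0 Normc.normc0.
by rewrite !big_ord_recr /=; apply: le_trans (le_normcD _ _) _; rewrite lerD2r.
Qed.

(** Stands in for Hölder's inequality on sets of finite measure: it bounds a modulus by an
    integrable function, uniformly in [p]. *)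
Lemma le_1D_powR (p t : R) : 1 <= p -> 0 <= t -> t <= 1 + t `^ p.
Proof.
move=> p1 t0; have [t1|t1] := leP t 1.
  by apply: le_trans t1 _; rewrite lerDl powR_ge0.
by apply: le_trans (le1r_powR (ltW t1) p1) _; rewrite lerDr.
Qed.

Lemma powR_pnorm (p : R) f : 1 <= p ->
  (pnorm mu p f `^ p = \int[mu]_x (Normc.normc (f x) `^ p)%:E)%E.
Proof.
move=> p1; rewrite /pnorm powR_Lnorm ?gt_eqF//; last exact: lt_le_trans p1.
by apply: eq_integral => x _; rewrite /= ger0_norm ?normc_ge0.
Qed.

(** The integral of [q] is enlarged to the whole group because only there is it invariant under
    translation. *)
Lemma integral_1D_le (K : set (Borel G)) (q : Borel G -> R) :
  measurable K -> measurable_fun setT q -> (forall x, 0 <= q x) ->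
  (\int[mu]_(x in K) (1 + q x)%:E <= mu K + \int[mu]_x (q x)%:E)%E.
Proof.
move=> mK mq q0.
have mqE : measurable_fun setT (fun x => (q x)%:E) by exact/measurable_EFinP.
under eq_integral do rewrite EFinD.
rewrite ge0_integralD//; [|by move=> x _; rewrite lee_fin|exact: measurable_funTS].
rewrite integral_cst// mul1e leeD2l// ge0_subset_integral//.
by move=> x _; rewrite lee_fin.
Qed.

(** * Right translations and iterates of the weighted translation *)

Variables (mul : G -> G -> G) (inv : G -> G) (one : G).
Hypothesis LCG : is_LC_group mul inv one.

Lemma continuous_right_mul (y : G) : continuous (mul^~ y).
Proof.
case: LCG => _ cm _ _ _ x.
have : (fun z => mul z y) = (fun xy : G * G => mul xy.1 xy.2) \o (fun z => (z, y)) by [].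
move=> ->; apply: continuous_comp; last exact: cm.
by apply: cvg_pair; [exact: cvg_id|exact: cvg_cst].
Qed.

Lemma measurable_right_mul (y : G) :
  measurable_fun setT (mul^~ y : Borel G -> Borel G).
Proof. by apply: continuous_borel_measurable; exact: continuous_right_mul. Qed.

(** The left side integrates [q] against the pushforward of [mu] under right multiplication by [y].
    The preimage of [A] under this map is the translate of [A] by [inv y], so the pushforward is
    [mu] itself. *)
Lemma integral_right_translate (y : G) (q : Borel G -> R) :
  is_right_Haar mul mu -> measurable_fun setT q -> (forall x, 0 <= q x) ->
  (\int[mu]_x (q (mul x y))%:E = \int[mu]_x (q x)%:E)%E.
Proof.
move=> [_ inv_mu _ _ _] mq q0.
have mqE : measurable_fun setT (fun x => (q x)%:E) by exact/measurable_EFinP.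
have mphi := measurable_right_mul y.
have := @ge0_integral_pushforward _ _ _ _ R _ mphi mu setT (fun x => (q x)%:E)
  measurableT mqE.
rewrite preimage_setT => <-; last by move=> x _; rewrite lee_fin.
apply: eq_measure_integral => A mA _.
rewrite -[RHS](inv_mu A (inv y) mA) /pushforward; congr (mu _).
have [[mA' m1x mx1 mVx mxV] _ _ _ _] := LCG.
apply/seteqP; split => [x Ax|_ [x Ax <-]] /=.
  by exists (mul x y) => //; rewrite -mA' mxV mx1.
by rewrite -mA' mVx mx1.
Qed.

Lemma iter_wtrans (g : G) (w : G -> R) (k : nat) (f : G -> R[i]) (x : G) :
  iter k (wtrans mul inv g w) f x =
  (wprod mul inv one g w k x)%:C%C *
    f (mul x (inv (gpow mul inv one g (Posz k)))).
Proof.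
have [[mA m1x mx1 mVx mxV] _ _ _ _] := LCG.
have invK y z : mul y z = one -> z = inv y.
  by move=> yz; rewrite -(m1x z) -(mVx y) -mA yz mx1.
have inv1 : inv one = one by symmetry; apply: invK.
have invM y z : inv (mul y z) = mul (inv z) (inv y).
  by symmetry; apply: invK; rewrite mA -(mA y) mxV mx1 mxV.
elim: k f => [|k IH] f.
  by rewrite /wprod big_ord0 mul1r /= inv1 mx1.
(* The innermost operator is peeled off: applying the induction hypothesis to [wtrans f] produces
   the new weight at [x g^-k], which is the last factor of the product. *)
rewrite iterSr IH /wtrans /wprod big_ord_recr /= rmorphM /= mulrA.
by rewrite invM mA.
Qed.

Lemma measurable_wprod (g : G) (w : G -> R) (k : nat) :
  measurable_fun setT (w : Borel G -> R) ->
  measurable_fun setT (wprod mul inv one g w k : Borel G -> R).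
Proof.
move=> mw; apply: measurable_prod => i _.
exact: (measurableT_comp mw (measurable_right_mul _)).
Qed.

Lemma measurableC_iter_wtrans (g : G) (w : G -> R) (k : nat) f :
  measurable_fun setT (w : Borel G -> R) -> Defs.measurableC f ->
  Defs.measurableC (iter k (wtrans mul inv g w) f).
Proof.
move=> mw mf; rewrite (_ : iter _ _ _ = (fun x => (wprod mul inv one g w k x)%:C%C *
    f (mul x (inv (gpow mul inv one g (Posz k)))))).
  apply: measurableCZ; first exact: measurable_wprod.
  exact: (measurableC_comp (measurable_right_mul _) mf).
by apply/funext => x; exact: iter_wtrans.
Qed.

End borel_group.

(** * Bounded weight products exclude convex-cyclicity *)

Lemma bounded_wprod_not_convex_cyclic (R : realType) (G : ptopologicalType)
    (mul : G -> G -> G) (inv : G -> G) (one : G)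
    (mu : {measure set (Borel G) -> \bar R}) (p : R) (g : G) (w : G -> R)
    (K : set (Borel G)) (C : R) :
  is_LC_group mul inv one -> is_right_Haar mul mu -> 1 <= p ->
  (forall x, 0 < w x) -> measurable_fun [set: Borel G] (w : Borel G -> R) ->
  measurable K -> (0 < mu K)%E -> (mu K < +oo)%E -> 0 <= C ->
  (forall k, {ae mu, forall x, K x -> wprod mul inv one g w k x <= C}) ->
  ~ convex_cyclic mu p (wtrans mul inv g w).
Proof.
move=> LCG haar p1 w0 mw mK K0 Koo C0 WC [f [[mf fLp] fcyc]].
have p0 : 0 < p by exact: lt_le_trans p1.
pose P x := Normc.normc (f x) `^ p.
have P0 x : 0 <= P x by exact: powR_ge0.
have mP : measurable_fun setT P.
  exact: (measurableT_comp (measurable_powR p) (measurable_normc mf)).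
have Ioo : (\int[mu]_x (P x)%:E < +oo)%E.
  by rewrite -powR_pnorm//; exact: poweR_lty.
have I0 : (0 <= \int[mu]_x (P x)%:E)%E.
  by apply: integral_ge0 => x _; rewrite lee_fin.
have Ifin : (\int[mu]_x (P x)%:E)%E \is a fin_num by rewrite ge0_fin_numE.
have Kfin : mu K \is a fin_num by rewrite ge0_fin_numE.
set kap := fine (mu K); set i0 := fine (\int[mu]_x (P x)%:E)%E.
have kap0 : 0 < kap by rewrite fine_gt0// K0 Koo.
(* Chosen so that [lam * kap] exceeds by [kap > 0] the bound [kap + 1 + C * (kap + i0)] obtained
   below for the integral of [lam] over [K]. *)
pose lam := 1 + (kap + 1 + C * (kap + i0)) / kap.
have i00 : 0 <= i0 by exact: fine_ge0.
have lam0 : 0 <= lam.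
  have C1 : 0 <= C * (kap + i0) by rewrite mulr_ge0// addr_ge0// ltW.
  by rewrite addr_ge0// divr_ge0 ?(ltW kap0)//; lra.
pose h x := (lam * \1_K x)%:C%C : R[i].
have hN x : Normc.normc (h x) = lam * \1_K x.
  by rewrite normc_real ger0_norm// mulr_ge0.
have mh : Defs.measurableC h.
  apply: measurableC_real; apply: measurable_funM => //.
have hLp : inLp mu p h.
  split => //; have pn0 : p != 0 by rewrite gt_eqF.
  apply: (lty_poweRy pn0); rewrite powR_pnorm//.
  rewrite (_ : integral _ _ _ = (\int[mu]_x ((lam `^ p)%:E * (\1_K x)%:E))%E); last first.
    apply: eq_integral => x _; rewrite hN -EFinM indicE.
    by case: (x \in K); rewrite ?mulr1 ?mulr0// powR0.
  rewrite ge0_integralZl//; last by rewrite lee_fin powR_ge0.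
    by rewrite integral_indic// setIT lte_mul_pinfty// lee_fin powR_ge0.
  exact/measurable_EFinP/measurable_indic.
have [N [c [c0 [c1 lt1]]]] := fcyc h hLp 1 ltr01.
pose S x := \sum_(k < N.+1) (c k)%:C%C * iter k (wtrans mul inv g w) f x.
have mS : Defs.measurableC S.
  apply: (@measurableC_sum _ _ _ (fun k x => (c k)%:C%C * iter k (wtrans mul inv g w) f x)) => k.
  apply: measurableCZ; first exact: measurable_cst.
  exact: (measurableC_iter_wtrans (one := one)).
pose r x := Normc.normc (h x - S x).
have mr : measurable_fun setT r by apply: measurable_normc; exact: measurableCB.
pose t k (x : Borel G) : R := P (mul x (inv (gpow mul inv one g (Posz k)))).
have mt k : measurable_fun setT (t k).
  exact: (measurableT_comp mP (measurable_right_mul LCG _)).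
have tI k : (\int[mu]_x (t k x)%:E = \int[mu]_x (P x)%:E)%E.
  by have := integral_right_translate LCG (inv (gpow mul inv one g k)) haar mP P0.
have rI : (\int[mu]_x (r x `^ p)%:E <= 1)%E.
  rewrite -(powR_pnorm mu (fun x => h x - S x))//.
  have -> : 1%E = (1 `^ p)%E :> \bar R by rewrite poweR_EFin powR1.
  apply: gt0_ler_poweR; rewrite ?(ltW p0)//.
  - by rewrite in_itv/= leey andbT Lnorm_ge0.
  - by rewrite in_itv/= leey andbT lee01.
  - exact: ltW lt1.
have mrp : measurable_fun setT (fun x => r x `^ p).
  exact: (measurableT_comp (measurable_powR p) mr).
have rp0 x : 0 <= r x `^ p by exact: powR_ge0.
have t0 k x : 0 <= t k x by exact: P0.
(* Triangle inequality for [h = (h - S) + S] on [K], each modulus being majorized through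
   [le_1D_powR]. The countably many null sets, one for each [k], are merged into one. *)
have key : {ae mu, forall x, K x ->
    (lam%:E <= (1 + r x `^ p)%:E + \sum_(k < N.+1) ((c k * C)%:E * (1 + t k x)%:E))%E}.
  have /ae_foralln := WC; apply: filterS => x Wx Kx.
  under eq_bigr do rewrite -EFinM.
  rewrite sumEFin -EFinD lee_fin.
  have -> : lam = Normc.normc (h x) by rewrite hN indicE mem_set ?mulr1.
  have -> : h x = (h x - S x) + S x by rewrite subrK.
  apply: le_trans (le_normcD _ _) _; apply: lerD.
    by apply: le_1D_powR => //; exact: normc_ge0.
  apply: le_trans (normc_sum _ (fun k => (c k)%:C%C * iter k (wtrans mul inv g w) f x)) _.
  apply: ler_sum => k _.
  rewrite Normc.normcM normc_real ger0_norm// -mulrA ler_wpM2l//.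
  rewrite (iter_wtrans LCG) Normc.normcM normc_real ger0_norm; last first.
    by apply: prodr_ge0 => i _; exact: ltW.
  apply: ler_pM; rewrite ?normc_ge0//.
  - by apply: prodr_ge0 => i _; exact: ltW.
  - exact: Wx.
  - by apply: le_1D_powR => //; exact: normc_ge0.
have m1r : measurable_fun K (fun x => (1 + r x `^ p)%:E).
  by apply/measurable_EFinP/measurable_funTS/measurable_funD.
have m1t k : measurable_fun K (fun x => (1 + t k x)%:E).
  by apply/measurable_EFinP/measurable_funTS/measurable_funD.
have m1s k : measurable_fun K (fun x => ((c k * C)%:E * (1 + t k x)%:E)%E).
  by apply: measurable_funeM.
have s0 k x : (0 <= (c k * C)%:E * (1 + t k x)%:E)%E.
  by rewrite -EFinM lee_fin !mulr_ge0// addr_ge0.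
have sum0 x : (0 <= \sum_(k < N.+1) ((c k * C)%:E * (1 + t k x)%:E))%E.
  by apply: sume_ge0.
have r10 x : (0 <= (1 + r x `^ p)%:E)%E by rewrite lee_fin addr_ge0.
have msum : measurable_fun K (fun x => \sum_(k < N.+1) ((c k * C)%:E * (1 + t k x)%:E))%E.
  by apply: emeasurable_sum => k.
(* Integrate [key] over [K]. By invariance every iterate contributes the same bound
   [C * (kap + i0)], and the [c k] sum to 1, so the result does not depend on [N]. *)
have : (lam%:E * mu K <= (mu K + 1) + (C * (kap + i0))%:E)%E.
  rewrite -integral_cst//.
  apply: (le_trans (ae_ge0_le_integral mK _ _ _ _ key)) => //.
  - by move=> x _; rewrite adde_ge0.
  - exact: emeasurable_funD.
  rewrite ge0_integralD//; apply: leeD.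
    by apply: le_trans (integral_1D_le _ mK mrp rp0) _; rewrite leeD2l.
  rewrite (ge0_integral_sum mu mK (fun k : 'I_N.+1 => m1s k)); last by move=> k x _; exact: s0.
  apply: (@le_trans _ _ (\sum_(k < N.+1) (c k * (C * (kap + i0)))%:E)%E); last first.
    by rewrite sumEFin -mulr_suml c1 mul1r.
  apply: lee_sum => k _.
  rewrite ge0_integralZl//; [|by move=> x _; rewrite lee_fin addr_ge0|by rewrite lee_fin mulr_ge0].
  rewrite mulrA [leRHS]EFinM; apply: lee_wpmul2l; first by rewrite lee_fin mulr_ge0.
  apply: le_trans (integral_1D_le _ mK (mt k) (t0 k)) _.
  by rewrite tI EFinD !fineK.
rewrite -(fineK Kfin) -/kap -EFinM -!EFinD lee_fin /lam mulrDl mul1r divfK ?gt_eqF//.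
by lra.
Qed.

(** * From unbounded essential suprema to the infinite limit inferior *)

Theorem theorem2p3 (R : realType) (G : ptopologicalType)
    (mul : G -> G -> G) (inv : G -> G) (one : G)
    (mu : {measure set (Borel G) -> \bar R})
    (p : R) (g : G) (w : G -> R) :
  is_LC_group mul inv one ->
  is_right_Haar mul mu ->
  1 <= p ->
  aperiodic mul inv one g ->
  (forall x, 0 < w x) ->
  (exists M : R, forall x, w x <= M) ->
  measurable_fun [set: Borel G] (w : Borel G -> R) ->
  convex_cyclic mu p (wtrans mul inv g w) ->
  adjoint_point_spectrum_empty mu p (wtrans mul inv g w) ->
  forall K : set G, compact K -> (0 < mu K)%E ->
  exists (N0 : nat) (E : nat -> set (Borel G)) (a : nat -> R),
    (forall n, measurable (E n) /\ E n `<=` K) /\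
    (forall n, 0 <= a n <= 1) /\
    ((fun n => \sum_(i < n) a i) @ \oo --> (1 : R)) /\
    limn_einf (fun n => esssup_on mu (E n)
       (fun x => \sum_(k < n.+1) a k * wprod mul inv one g w (N0 + k) x)) = +oo%E.
Proof.
move=> LCG haar p1 _ w0 [M wM] mw ccyc _ K cK K0.
have W0 k x : 0 <= wprod mul inv one g w k x.
  by apply: prodr_ge0 => i _; exact: ltW.
have mK : measurable (K : set (Borel G)).
  by apply: compact_borel_measurable => //; case: LCG.
have Koo : (mu K < +oo)%E by case: haar => _ _ /(_ K cK).
pose u m := esssup_on mu K (wprod mul inv one g w m).
have uP (C : R) N : exists m, (N <= m)%N /\ (C%:E <= u m)%E.
  apply: contrapT => /forallNP uC.
  have B1 : 1 <= Num.max M 1 by rewrite le_max lexx orbT.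
  (* If all [u m] with [m >= N] were below [C], then [C'] would bound every product almost
     everywhere on [K]: the indices below [N] are covered by powers of [Num.max M 1], which increase
     with the exponent because the base is at least 1. *)
  pose C' := Num.max C (Num.max M 1 ^+ N).
  have C'0 : 0 <= C' by rewrite le_max exprn_ge0 ?orbT// (le_trans ler01).
  apply: (bounded_wprod_not_convex_cyclic LCG haar p1 w0 mw mK K0 Koo C'0 _ ccyc).
  move=> k; have [Nk|kN] := leqP N k.
    have /ess_supP : (u k <= C%:E)%E.
      by rewrite leNgt; apply/negP => /ltW Cu; exact: (uC k).
    apply: filterS => x + Kx; rewrite mem_set// lee_fin ger0_norm// => WC.
    by rewrite le_max WC.
  apply: nearW => x _; rewrite le_max; apply/orP; right.
  apply: (@le_trans _ _ (Num.max M 1 ^+ k)); last exact: ler_weXn2l (ltnW kN).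
  rewrite -[in leRHS](card_ord k) -prodr_const /wprod.
  by apply: ler_prod => i _; rewrite ltW//= le_max wM.
have [a [a01 asum aC]] := summable_weights_unbounded uP.
exists 0%N, (fun=> K), a; do !split => //.
(* The sequence itself tends to [+oo]: once [n >= k], the sum dominates its single term of index
   [k], all terms being nonnegative. Pulling [a k] out of the essential supremum uses [0 < a k]. *)
apply: (cvg_limn_einf_sup _).1; apply/cvgeyPge => C.
have [k [ak Ck]] := aC C.
exists k => // n /= kn; apply: (le_trans Ck).
rewrite -ess_sup_pZl//; apply: le_ess_sup; apply: nearW => x /=.
case: ifPn => _; last by rewrite mule0.
have a0 i : 0 <= a i by case/andP: (a01 i).
rewrite -EFinM lee_fin !ger0_norm ?sumr_ge0// => [|i _]; last by rewrite mulr_ge0.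
have kn1 : (k < n.+1)%N by [].
rewrite (bigD1 (Ordinal kn1))//= add0n lerDl sumr_ge0// => i _.
by rewrite mulr_ge0.
Qed.
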